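(* Let $m>1$, let $L_{m+1}=\{(x,x^{m+1})\in\mathbb R^{m+1}: x\in\mathbb R^m,\ x^{m+1}\in\mathbb R,\ \|x\|\le x^{m+1}\}$ be the $(m+1)$-dimensional Lorentz cone, and let $M\subset\mathbb R^{m+1}$ be a closed convex set with nonempty interior. Then the following assertions are equivalent: (i) $M$ is invariant with respect to the operations $\sqcap$ and $\sqcup$ defined by the Lorentz cone $L_{m+1}$; (ii) $M$ is an $L_{m+1}$-isotone projection set; (iii) $M=C\times\mathbb R$, where $C$ is a closed convex set with nonempty interior in $\mathbb R^m$.
   Context: $\mathbb R^{m+1}=\mathbb R^m\times\mathbb R$ carries the standard inner product; $\|\cdot\|$ is the Euclidean norm. For a nonempty closed convex set $D$, $P_Dx$ is the unique nearest point of $D$ to $x$. With $K=L_{m+1}$ (a self-dual cone), put $x\sqcap y=P_{x-K}y$ and $x\sqcup y=P_{x+K}y$. A set $M$ is invariant with respect to $\sqcap$ (resp. $\sqcup$) if $x,y\in M$ implies $x\sqcap y\in M$ (resp. $x\sqcup y\in M$). Write $x\le y\iff y-x\in K$. A nonempty closed convex set $M$ is a $K$-isotone projection set if $x\le y$ implies $P_Mx\le P_My$ for all $x,y\in\mathbb R^{m+1}$. *)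

(* Defs.v *)
From mathcomp Require Import all_boot all_order all_algebra.
From mathcomp Require Import all_classical all_reals all_analysis.

Set Implicit Arguments.
Unset Strict Implicit.
Unset Printing Implicit Defensive.
Import Order.TTheory GRing.Theory Num.Theory.
Import numFieldNormedType.Exports.
Local Open Scope classical_set_scope.
Local Open Scope ring_scope.

Definition dotv (R : realType) (n : nat) (x y : 'rV[R]_n) : R :=
  \sum_(i < n) x 0 i * y 0 i.

(* The library norm `|x| on 'rV[R]_n is the sup norm; it induces the same
   topology as the Euclidean one, so closed, interior, etc. are taken from
   the library. *)
Definition enorm (R : realType) (n : nat) (x : 'rV[R]_n) : R :=
  Num.sqrt (dotv x x).

Definition is_nearest (R : realType) (n : nat) (D : set 'rV[R]_n)
    (x p : 'rV[R]_n) : Prop :=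
  D p /\ forall q, D q -> enorm (x - p) <= enorm (x - q).

(* The nearest point exists and is unique when D is nonempty, closed and
   convex; otherwise the value is a point nearest to x chosen arbitrarily,
   or 0 if there is none. *)
Definition proj (R : realType) (n : nat) (D : set 'rV[R]_n)
    (x : 'rV[R]_n) : 'rV[R]_n :=
  xget 0 [set p | is_nearest D x p].

Definition cone_meet (R : realType) (n : nat) (K : set 'rV[R]_n)
    (x y : 'rV[R]_n) : 'rV[R]_n :=
  proj [set x - k | k in K] y.

Definition cone_join (R : realType) (n : nat) (K : set 'rV[R]_n)
    (x y : 'rV[R]_n) : 'rV[R]_n :=
  proj [set x + k | k in K] y.

Definition invariant_under (T : Type) (op : T -> T -> T) (M : set T) : Prop :=
  forall x y, M x -> M y -> M (op x y).

Definition cone_le (R : realType) (n : nat) (K : set 'rV[R]_n)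
    (x y : 'rV[R]_n) : Prop :=
  K (y - x).

Definition isotone_projection_set (R : realType) (n : nat)
    (K M : set 'rV[R]_n) : Prop :=
  [/\ M !=set0, closed M, convex_set M &
      forall x y, cone_le K x y -> cone_le K (proj M x) (proj M y)].

(* R^m x R is identified with 'rV[R]_(m + 1): the pair (x, t) is
   row_mx x t%:M, where t%:M is the 1 x 1 matrix with entry t. *)
Definition lorentz_cone (R : realType) (m : nat) : set 'rV[R]_(m + 1) :=
  [set z | exists (x : 'rV[R]_m) (t : R),
     z = row_mx x t%:M /\ enorm x <= t].

Definition cylinder (R : realType) (m : nat) (C : set 'rV[R]_m) :
    set 'rV[R]_(m + 1) :=
  [set z | exists (x : 'rV[R]_m) (t : R), z = row_mx x t%:M /\ C x].

(* Main.v *)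
(* Invariance gives isotonicity: for x <= y, put u = P_M x, v = P_M y and let
   u - v = k - k' be the Moreau decomposition with respect to the self-dual
   cone.  The meet and the join of u and v are u - k and v + k; testing the
   variational inequalities of u and v against them gives <u - v, k> <= 0,
   that is k = 0, so v - u = k' lies in the cone.

   Isotonicity forces vertical lines: at a boundary point p touched from
   inside by a ball in M, with normal a, the projection of p + e x moves, to
   first order, like the projection on a half-space.  If x and y are orthogonal
   in the cone, isotonicity then forbids <a, x> and <a, y> to have the same
   sign.  Taking x = (u, 1), y = (-u, 1) with u a unit vector orthogonal to the
   horizontal part of a (here 1 < m is used) shows that a is horizontal.  As all
   such normals are horizontal, the inner radius of M is constant along
   vertical lines, which therefore never leave M. *)

Require Import Defs.
From mathcomp Require Import all_boot all_order all_algebra.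
From mathcomp Require Import all_classical all_reals all_analysis.
From mathcomp Require Import ring lra.

Set Implicit Arguments.
Unset Strict Implicit.
Unset Printing Implicit Defensive.
Import Order.TTheory GRing.Theory Num.Theory.
Import numFieldNormedType.Exports.
Local Open Scope classical_set_scope.
Local Open Scope ring_scope.

(** * Euclidean inner product and norm *)

Section Euclid.
Context {R : realType} {n : nat}.
Implicit Types (x y z u v w p q : 'rV[R]_n) (D M : set 'rV[R]_n).

Lemma dotvC x y : dotv x y = dotv y x.
Proof. by apply: eq_bigr => i _; rewrite mulrC. Qed.

Lemma dotvDl x y z : dotv (x + y) z = dotv x z + dotv y z.
Proof. by rewrite -big_split; apply: eq_bigr => i _; rewrite mxE mulrDl. Qed.

Lemma dotvZl c x z : dotv (c *: x) z = c * dotv x z.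
Proof. by rewrite mulr_sumr; apply: eq_bigr => i _; rewrite mxE mulrA. Qed.

Lemma dotvNl x z : dotv (- x) z = - dotv x z.
Proof. by rewrite -scaleN1r dotvZl mulN1r. Qed.

Lemma dotv0l z : dotv 0 z = 0.
Proof. by rewrite -(scale0r 0) dotvZl mul0r. Qed.

Lemma dotvDr x y z : dotv z (x + y) = dotv z x + dotv z y.
Proof. by rewrite dotvC dotvDl !(dotvC z). Qed.

Lemma dotvZr c x z : dotv z (c *: x) = c * dotv z x.
Proof. by rewrite dotvC dotvZl (dotvC z). Qed.

Lemma dotvNr x z : dotv z (- x) = - dotv z x.
Proof. by rewrite dotvC dotvNl (dotvC z). Qed.

Lemma dotv0r z : dotv z 0 = 0.
Proof. by rewrite dotvC dotv0l. Qed.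

Definition dotvE := (dotvDl, dotvDr, dotvNl, dotvNr, dotvZl, dotvZr).

Lemma sqr_dotvB x y : dotv (x - y) (x - y) = dotv x x - 2 * dotv x y + dotv y y.
Proof. by rewrite !dotvE (dotvC y x); ring. Qed.

Lemma dotv_ge0 x : 0 <= dotv x x.
Proof. by apply: sumr_ge0 => i _; rewrite -expr2 sqr_ge0. Qed.

Lemma sqr_coord_le_dotv x i : x 0 i ^+ 2 <= dotv x x.
Proof.
by rewrite /dotv (bigD1 i) //= -expr2 lerDl sumr_ge0// => j _; rewrite -expr2 sqr_ge0.
Qed.

Lemma dotv_eq0 x : (dotv x x == 0) = (x == 0).
Proof.
apply/eqP/eqP => [x0|->]; last exact: dotv0l.
apply/rowP => i; rewrite mxE; apply/eqP; rewrite -sqrf_eq0 eq_le sqr_ge0 andbT.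
by rewrite -x0 sqr_coord_le_dotv.
Qed.

Lemma enorm_ge0 x : 0 <= enorm x.
Proof. exact: sqrtr_ge0. Qed.

Lemma sqr_enorm x : enorm x ^+ 2 = dotv x x.
Proof. by rewrite sqr_sqrtr// dotv_ge0. Qed.

Lemma enorm_eq0 x : (enorm x == 0) = (x == 0).
Proof. by rewrite -dotv_eq0 -sqr_enorm sqrf_eq0. Qed.

Lemma enorm_gt0 x : (0 < enorm x) = (x != 0).
Proof. by rewrite lt_def enorm_ge0 andbT enorm_eq0. Qed.

Lemma enorm0 : enorm (0 : 'rV[R]_n) = 0.
Proof. by apply/eqP; rewrite enorm_eq0. Qed.

Lemma enormZ c x : enorm (c *: x) = `|c| * enorm x.
Proof. by rewrite /enorm !dotvE mulrA -expr2 sqrtrM ?sqr_ge0// sqrtr_sqr. Qed.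

Lemma enormN x : enorm (- x) = enorm x.
Proof. by rewrite -scaleN1r enormZ normrN1 mul1r. Qed.

Lemma enormB x y : enorm (x - y) = enorm (y - x).
Proof. by rewrite -enormN opprB. Qed.

(** Cauchy-Schwarz: with [a] and [b] the norms of [x] and [y], the square of the norm of [b x - a y]
    is [2ab(ab - <x, y>)]. *)
Lemma dotv_le_enorm x y : dotv x y <= enorm x * enorm y.
Proof.
have [->|x0] := eqVneq x 0; first by rewrite dotv0l enorm0 mul0r.
have [->|y0] := eqVneq y 0; first by rewrite dotv0r enorm0 mulr0.
have a0 : 0 < enorm x by rewrite enorm_gt0.
have b0 : 0 < enorm y by rewrite enorm_gt0.
have := dotv_ge0 (enorm y *: x - enorm x *: y).
rewrite !dotvE (dotvC y x) -!sqr_enorm => h.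
have : 0 <= 2 * (enorm x * enorm y) * (enorm x * enorm y - dotv x y).
  by apply: le_trans h _; rewrite le_eqVlt; apply/orP; left; apply/eqP; ring.
by rewrite pmulr_rge0 ?subr_ge0// !mulr_gt0.
Qed.

Lemma ler_enormD x y : enorm (x + y) <= enorm x + enorm y.
Proof.
rewrite -(@ler_pXn2r _ 2) ?nnegrE ?addr_ge0 ?enorm_ge0//.
rewrite sqrrD !sqr_enorm !dotvE (dotvC y x).
by have := dotv_le_enorm x y; lra.
Qed.

Lemma enorm_le_sqr x y : (enorm x <= enorm y) = (dotv x x <= dotv y y).
Proof. by rewrite -!sqr_enorm ler_pXn2r// nnegrE enorm_ge0. Qed.

Lemma mx_norm_le_enorm x : `|x| <= enorm x.
Proof.
rewrite -[`|x|]/(mx_norm x).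
have [->|/mx_norm_neq0 [[i j] /= ->]] := eqVneq (mx_norm x) 0.
  exact: enorm_ge0.
by rewrite (ord1 i) -sqrtr_sqr ler_wsqrtr// sqr_coord_le_dotv.
Qed.

(** * Euclidean balls, topology and convexity *)

Lemma dotv_continuous (f g : 'rV[R]_n -> 'rV[R]_n) :
  continuous f -> continuous g -> continuous (fun x => dotv (f x) (g x)).
Proof.
move=> cf cg; apply: continuous_big => [|i _ x]; first exact: add_continuous.
have cc (h : 'rV[R]_n -> 'rV[R]_n) : continuous h -> continuous (fun y => h y 0 i).
  move=> ch y; apply: (@continuous_comp _ _ _ h (fun y : 'rV_n => y 0 i)).
    exact: ch.
  exact: coord_continuous.
exact: (cvgM (cc f cf x) (cc g cg x)).
Qed.

Lemma enormB_continuous z : continuous (fun x => enorm (x - z)).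
Proof.
have cB : continuous (fun x : 'rV[R]_n => x - z).
  by move=> x; exact: (cvgB (@cvg_id _ (nbhs x)) (cvg_cst z)).
move=> x; apply: (@continuous_comp _ _ _ (fun x => dotv (x - z) (x - z)) Num.sqrt).
  exact: (@dotv_continuous (fun y => y - z) (fun y => y - z) cB cB x).
exact: sqrt_continuous.
Qed.

Lemma open_enorm_ball z r : open [set x | enorm (x - z) < r].
Proof.
apply: (@open_comp _ _ (fun x => enorm (x - z)) [set t | t < r]).
  by move=> x _; exact: enormB_continuous.
exact: open_lt.
Qed.

(** Bridge to the sup-norm topology: the sup norm is at most the Euclidean one, and Euclidean balls
    are open. *)
Lemma nbhs_enormP M z :
  nbhs z M <-> exists2 r, 0 < r & forall x, enorm (x - z) < r -> M x.
Proof.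
split.
  move=> /nbhs_ballP [r /= r0 rM]; exists r => // x xr; apply: rM.
  by rewrite mx_norm_ball /ball_ /= distrC (le_lt_trans (mx_norm_le_enorm _)).
move=> [r r0 rM]; apply: (filterS rM); apply: open_nbhs_nbhs; split.
  exact: open_enorm_ball.
by rewrite /= subrr enorm0.
Qed.

Lemma closed_enormP M :
  closed M <->
  forall x, (forall e, 0 < e -> exists2 y, M y & enorm (y - x) < e) -> M x.
Proof.
split=> [cM x xM|cM x clx]; [apply: cM => A|apply: cM => e e0].
  move=> /nbhs_enormP [r r0 rA]; have [y My yr] := xM r r0.
  by exists y; split=> //; exact: rA.
have [|y [My ye]] := clx [set y | enorm (y - x) < e]; last by exists y.
by apply/nbhs_enormP; exists e.
Qed.

(** Replaces the interval-typed coefficient of [convex_set] by a real with explicit bounds. *)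
Lemma convex_setP M : convex_set M <->
  forall x y t, 0 <= t -> t <= 1 -> M x -> M y -> M (t *: x + (1 - t) *: y).
Proof.
split=> [cM x y t t0 t1 Mx My|cM x y t].
  have t01 : Itv.spec (Itv.num_sem (R := R)) (Itv.Real `[0%Z, 1%Z]) t.
    by rewrite /= /Itv.num_sem num_real /= in_itv /= t0 t1.
  have := cM x y (Itv.Def t01); rewrite !inE; exact.
rewrite !inE => Mx My; apply: cM => //.
Qed.

End Euclid.

(** * Nearest points and the variational inequality *)

Section Projection.
Context {R : realType} {n : nat}.
Implicit Types (x y z u v w p q a : 'rV[R]_n) (D M : set 'rV[R]_n).

(** The part of [D] no farther from [x] than some [d] in [D] is compact, so the distance attains its
    minimum there. *)
Lemma proj_nearest D x : closed D -> D !=set0 -> is_nearest D x (Defs.proj D x).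
Proof.
move=> cD [d Dd].
pose A := D `&` [set q | enorm (q - x) <= enorm (d - x)].
have A0 : A !=set0 by exists d; split=> /=.
have cA : closed A.
  apply: closedI => //.
  apply: (@preimage_closed _ _ (fun q => enorm (q - x)) [set t | t <= _]).
    by move=> q _; exact: enormB_continuous.
  exact: closed_le.
have bA : bounded_set A.
  exists (enorm (d - x) + `|x|); split=> [|r hr v [_ /= vd]]; first exact: num_real.
  rewrite -(subrK x v) (le_trans (ler_normD _ _))// (le_trans _ (ltW hr))//.
  by rewrite lerD2r (le_trans (mx_norm_le_enorm _)).
have [||c cAin minc] := @EVT_min_rV _ _ (fun q => enorm (q - x)) A A0.
- exact: bounded_closed_compact.
- by apply: continuous_subspaceT => q; exact: enormB_continuous.
apply: (@xgetI _ 0 [set p | is_nearest D x p] c).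
move: cAin; rewrite inE => -[Dc /= cd]; split=> // q Dq.
rewrite (enormB x c) (enormB x q).
have [qd|/ltW dq] := leP (enorm (q - x)) (enorm (d - x)); last exact: le_trans dq.
by apply: minc; rewrite inE.
Qed.

Lemma nearest_dotv_le0 D x p v :
  convex_set D -> is_nearest D x p -> D v -> dotv (x - p) (v - p) <= 0.
Proof.
move=> /convex_setP cD [Dp near] Dv; rewrite leNgt; apply/negP => c0.
set c := dotv _ _ in c0; set b := dotv (v - p) (v - p).
have b0 : 0 <= b by exact: dotv_ge0.
(* Moving from [p] towards [v] by [t] forces [2c <= tb], while this [t] satisfies [t <= 1] and
   [tb <= c]. *)
pose t := c / (b + c).
have bc : 0 < b + c by lra.
have t0 : 0 < t by rewrite divr_gt0.
have t1 : t <= 1 by rewrite ler_pdivrMr// mul1r; lra.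
have := near _ (cD v p t (ltW t0) t1 Dv Dp).
have -> : x - (t *: v + (1 - t) *: p) = (x - p) - t *: (v - p).
  by apply/rowP => i; rewrite !mxE; ring.
rewrite enorm_le_sqr (sqr_dotvB (x - p)) !dotvZl !dotvZr.
rewrite -/c -/b => h.
have {}h : t * (2 * c) <= t * (t * b) by lra.
rewrite ler_pM2l// in h.
have tb : t * b <= c.
  rewrite /t mulrAC ler_pdivrMr//; nra.
lra.
Qed.

(** The inequality gives [|x - q|^2 >= |x - p|^2 + |q - p|^2] on [D], so [p] is the only nearest
    point and [xget] has to pick it. *)
Lemma proj_eq D x p :
  D p -> (forall v, D v -> dotv (x - p) (v - p) <= 0) -> Defs.proj D x = p.
Proof.
move=> Dp vip.
have near : is_nearest D x p.
  split=> // q /vip; rewrite enorm_le_sqr.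
  have -> : x - q = (x - p) - (q - p) by rewrite opprB addrA subrK.
  set w := x - p; set d := q - p; rewrite (sqr_dotvB w) => h.
  by have := dotv_ge0 d; lra.
have [Dq nearq] := @xgetI _ 0 [set p | is_nearest D x p] p near.
have := nearq _ Dp; have := vip _ Dq.
rewrite -/(Defs.proj D x) enorm_le_sqr; set q := Defs.proj D x => h1.
have -> : x - q = (x - p) - (q - p) by rewrite opprB addrA subrK.
set w := x - p; set d := q - p.
rewrite (sqr_dotvB w) => h2.
apply/eqP; rewrite -subr_eq0 -dotv_eq0 eq_le dotv_ge0 andbT -/d.
by move: h1; rewrite -/w -/d; lra.
Qed.

(** * Touching balls and translation invariance *)

(* The inner ball makes [p] a smooth boundary point, so that near [p] the
   projection on [M] behaves like the projection on a half-space. *)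
Definition inner_normal_ball M a p :=
  [/\ a != 0, forall v, enorm (v - (p - a)) <= enorm a -> M v &
      forall v, M v -> dotv a (v - p) <= 0].

(** [p] is a point nearest to [z] outside the interior of [M]: the open ball around [z] reaching to
    [p] is interior, and its closure lies in the closed set [M]. *)
Lemma inner_normal_ballP M z y :
  closed M -> convex_set M -> nbhs z M -> ~ nbhs y M ->
  exists2 p : 'rV[R]_n, ~ nbhs p M & inner_normal_ball M (p - z) p /\
    (forall v, enorm (v - z) < enorm (p - z) -> nbhs v M).
Proof.
move=> cM /convex_setP coM zM yM.
pose F := ~` interior M.
have cF : closed F by apply: open_closedC; exact: open_interior.
have [Fp nearp] : is_nearest F z (Defs.proj F z) by apply: proj_nearest => //; exists y.
move: (Defs.proj F z) Fp nearp => p Fp nearp.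
have pz : p - z != 0 by rewrite subr_eq0; apply: contra_not_neq Fp => ->.
have ball v : enorm (v - z) < enorm (p - z) -> nbhs v M.
  rewrite ltNge => /negP vp; apply: contrapT => Fv; apply: vp.
  by rewrite (enormB v) (enormB p); exact: nearp.
have a0 : 0 < enorm (p - z) by rewrite enorm_gt0.
exists p => //; split=> //; split=> //.
- rewrite subKr => v va.
  move/closed_enormP : cM; apply=> e e0.
  (* Pulling [v] towards [z] by this ratio enters the open ball and moves [v] by less than [e]. *)
  pose t := e / (e + enorm (p - z)).
  have t0 : 0 < t by rewrite divr_gt0// addr_gt0.
  have t1 : t < 1 by rewrite ltr_pdivrMr ?addr_gt0//; lra.
  exists (v - t *: (v - z)); last first.
    rewrite addrAC subrr sub0r enormN enormZ gtr0_norm//.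
    rewrite mulrAC ltr_pdivrMr ?addr_gt0//; nra.
  apply: nbhs_singleton; apply: ball.
  have -> : v - t *: (v - z) - z = (1 - t) *: (v - z).
    by apply/rowP => i; rewrite !mxE; ring.
  rewrite enormZ gtr0_norm ?subr_gt0//; nra.
- (* Otherwise [p] is an inner point of a segment from [v] to a point [b] of
     the open ball, so that [p] is interior to [M]. *)
  move=> v Mv; rewrite leNgt; apply/negP => c0.
  set a := p - z in pz ball a0 c0; set d := v - p in c0; set c := dotv a d in c0.
  have dd := dotv_ge0 d.
  (* As [s |d|^2 < c], the point [p - s d] is strictly closer to [z] than [p]. *)
  pose s := c / (dotv d d + c).
  have s0 : 0 < s by rewrite divr_gt0//; lra.
  have sd : s * dotv d d < c.
    rewrite /s mulrAC ltr_pdivrMr; [nra|lra].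
  have : nbhs (p - s *: d) M.
    apply: ball.
    have -> : p - s *: d - z = a - s *: d by rewrite addrAC.
    rewrite -(@ltr_pXn2r _ 2) ?nnegrE ?enorm_ge0//.
    rewrite !sqr_enorm (sqr_dotvB a) !dotvZl !dotvZr -/c.
    have : s * (s * dotv d d) < s * c by rewrite ltr_pM2l.
    have : 0 < s * c by rewrite mulr_gt0.
    lra.
  move/nbhs_enormP => [r r0 rM]; apply: Fp; apply/nbhs_enormP.
  have s1 : 0 < 1 + s by lra.
  exists (r / (1 + s)); first by rewrite divr_gt0.
  move=> x; rewrite ltr_pdivlMr// => xr.
  (* A displacement of [x] from [p] is magnified by [1 + s] at the other end of the segment, hence
     the radius [r / (1 + s)]. *)
  have -> : x = (s / (1 + s)) *: v +
      (1 - s / (1 + s)) *: ((p - s *: d) + (1 + s) *: (x - p)).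
    by apply/rowP => i; rewrite !mxE; field; lra.
  apply: coM => //.
  + by rewrite divr_ge0// ltW.
  + by rewrite ler_pdivrMr//; lra.
  + by apply: rM; rewrite addrAC subrr add0r enormZ gtr0_norm// mulrC.
Qed.

(** The way from [z] to [z + t e] is cut into steps shorter than [r]; after each one the next centre
    is still interior, and [step] restores the full radius [r]. *)
Lemma nbhs_convex_translate M e : closed M -> convex_set M ->
  (forall a p, inner_normal_ball M a p -> dotv a e = 0) ->
  forall z t, nbhs z M -> nbhs (z + t *: e) M.
Proof.
move=> cM coM ne z t /nbhs_enormP [r r0 rM].
(* The largest ball around [z1 + s *: e] inside [M] has a touching normal
   orthogonal to [e], so it is no smaller than a ball in [M] around [z1]. *)
have step z1 s : (forall v, enorm (v - z1) < r -> M v) -> nbhs (z1 + s *: e) M ->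
    forall v, enorm (v - (z1 + s *: e)) < r -> M v.
  move=> ball1 zs v vr; apply: contrapT => nMv.
  have nv : ~ nbhs v M by move=> /nbhs_singleton.
  have [p np [inb ballp]] := inner_normal_ballP cM coM zs nv.
  have [] := inb; have := ne _ _ inb.
  set a := p - (z1 + s *: e) => ae a0 _ half.
  have a_gt0 : 0 < enorm a by rewrite enorm_gt0.
  have ra : enorm a < r.
    by rewrite (le_lt_trans _ vr)// leNgt; apply/negP => /ballp.
  (* [k a] has length midway between those of [a] and [r]: [z1 + k a] is in the ball around [z1] but
     beyond the supporting hyperplane at [p]. *)
  pose k := (r + enorm a) / 2 / enorm a.
  have ka : k * enorm a = (r + enorm a) / 2 by rewrite /k divfK// gt_eqF.
  have k0 : 0 < k by rewrite divr_gt0// divr_gt0//; lra.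
  have : M (z1 + k *: a).
    by apply: ball1; rewrite addrAC subrr add0r enormZ gtr0_norm// ka; lra.
  move=> /half.
  have -> : z1 + k *: a - p = (k - 1) *: a - s *: e.
    by apply/rowP => i; rewrite !mxE; ring.
  rewrite dotvDr dotvNr !dotvZr ae mulr0 subr0 leNgt.
  rewrite pmulr_lgt0; last by rewrite -sqr_enorm exprn_gt0.
  rewrite subr_gt0 /k ltr_pdivlMr// mul1r; case/negP; lra.
pose N := Num.bound (enorm (t *: e) / r).
have N0 : (0 < N)%N.
  rewrite -(ltr_nat R); apply: le_lt_trans (archi_boundP _);
    by rewrite divr_ge0 ?enorm_ge0// ltW.
have N0' : 0 < N%:R :> R by rewrite ltr0n.
have hN : enorm ((t / N%:R) *: e) < r.
  have := @archi_boundP _ (enorm (t *: e) / r); rewrite -/N.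
  rewrite divr_ge0 ?enorm_ge0 ?ltW// => /(_ isT); rewrite ltr_pdivrMr// => h.
  by rewrite mulrC -scalerA enormZ gtr0_norm ?invr_gt0// mulrC ltr_pdivrMr// mulrC.
have ballk k : forall v, enorm (v - (z + (k%:R * (t / N%:R)) *: e)) < r -> M v.
  elim: k => [|k IH]; first by rewrite mul0r scale0r addr0.
  rewrite -natr1 mulrDl mul1r scalerDl addrA; apply: step => //.
  apply/nbhs_enormP; exists (r - enorm ((t / N%:R) *: e)); first by rewrite subr_gt0.
  move=> v vr; apply: IH.
  rewrite -[v](subrK ((t / N%:R) *: e)) addrAC (le_lt_trans (ler_enormD _ _))//.
  by move: vr; rewrite opprD addrA -addrA (addrC (- _)) addrA ltrBrDr.
apply/nbhs_enormP; exists r => //.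
by have := ballk N; rewrite mulrC divfK// gt_eqF.
Qed.

Lemma closed_convex_translate M e : closed M -> convex_set M -> interior M !=set0 ->
  (forall a p, inner_normal_ball M a p -> dotv a e = 0) ->
  forall v t, M v -> M (v + t *: e).
Proof.
move=> cM coM [z zM] ne v t Mv; move/closed_enormP: (cM); apply=> d d0.
have nz := enorm_ge0 (z - v).
pose l := d / (d + enorm (z - v)).
have s0 : 0 < d + enorm (z - v) by lra.
have l0 : 0 < l by rewrite divr_gt0.
have l1 : l <= 1 by rewrite ler_pdivrMr//; lra.
(* Shifting the interior point [z] by [t / l] makes the combination shift by exactly [t]; the
   remaining error [l (z - v)] is shorter than [d]. *)
exists (l *: (z + (t / l) *: e) + (1 - l) *: v).
  move/convex_setP: (coM); apply=> //; first exact: ltW.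
  by apply: nbhs_singleton; exact: nbhs_convex_translate.
have -> : l *: (z + (t / l) *: e) + (1 - l) *: v - (v + t *: e) = l *: (z - v).
  by apply/rowP => i; rewrite !mxE; field; lra.
rewrite enormZ gtr0_norm// mulrAC ltr_pdivrMr//; nra.
Qed.

End Projection.

(** Quantitative smoothness at [p]: the residual [w = p + x - q] is almost parallel to [a] when [x]
    is small. Since [<w, y> <= 0], a nonnegative [<a, y>] must then be small as well. *)
Lemma inner_normal_ball_proj {R : realType} {n : nat} (M : set 'rV[R]_n) a p q x y :
  convex_set M -> inner_normal_ball M a p -> is_nearest M (p + x) q ->
  0 < dotv a x -> dotv x y = 0 -> 0 <= dotv (q - p) y -> 0 <= dotv a y ->
  dotv a y ^+ 2 <= 2 * enorm a * enorm x * dotv y y.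
Proof.
move=> cM [a0 ball half] near ax xy qpy ay.
have [Mq _] := near.
have [w wdef] : exists w, w = p + x - q by exists (p + x - q).
set N := enorm w.
have wE : p - q = w - x by rewrite wdef addrAC addrK.
have qp : q - p = x - w by rewrite -opprB wE opprB.
have wy : dotv w y <= 0 by move: qpy; rewrite qp dotvDl dotvNl xy; lra.
have aw : 0 < dotv a w.
  by move: (half _ Mq); rewrite qp dotvDr dotvNr; lra.
have N0 : 0 < N.
  by rewrite enorm_gt0; apply: contraTneq aw => ->; rewrite dotv0r ltxx.
have wN : dotv w w = N ^+ 2 by rewrite sqr_enorm.
have aN : dotv a a = enorm a ^+ 2 by rewrite sqr_enorm.
have h1 : enorm a * N - dotv a w <= N * enorm x.
  (* This is the point of the inner ball farthest in the direction [w]. *)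
  have Mv : M (p - a + (enorm a / N) *: w).
    apply: ball; rewrite addrAC subrr add0r enormZ ger0_norm ?divfK ?gt_eqF//.
    by rewrite divr_ge0 ?enorm_ge0.
  have := nearest_dotv_le0 cM near Mv.
  have -> : p - a + (enorm a / N) *: w - q = w - x - a + (enorm a / N) *: w.
    by rewrite -wE; apply/rowP => i; rewrite !mxE; ring.
  rewrite -wdef !dotvDr !dotvNr dotvZr wN (dotvC w a).
  have -> : enorm a / N * N ^+ 2 = enorm a * N by field; rewrite gt_eqF.
  have := dotv_le_enorm w x; rewrite -/N; have := sqr_ge0 N; lra.
(* Because [<w, y> <= 0], subtracting [|a| w] from [N a] can only increase the product with [y]. *)
have h2 : N * dotv a y <= enorm (N *: a - enorm a *: w) * enorm y.
  apply: le_trans (dotv_le_enorm _ _); rewrite dotvDl dotvNl !dotvZl.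
  have := mulr_ge0_le0 (enorm_ge0 a) wy; lra.
have h3 : dotv (N *: a - enorm a *: w) (N *: a - enorm a *: w) =
    2 * enorm a * N * (enorm a * N - dotv a w).
  by rewrite sqr_dotvB !dotvZl !dotvZr wN aN; ring.
have h4 : N ^+ 2 * dotv a y ^+ 2 <= N ^+ 2 * (2 * enorm a * enorm x * dotv y y).
  have h0 : 0 <= N * dotv a y by rewrite mulr_ge0// ltW.
  rewrite -exprMn (le_trans (_ : _ <= (enorm (N *: a - enorm a *: w) * enorm y) ^+ 2))//.
    by rewrite ler_pXn2r// nnegrE// (le_trans h0).
  rewrite exprMn (sqr_enorm (_ - _)) (sqr_enorm y) h3.
  have -> : N ^+ 2 * (2 * enorm a * enorm x * dotv y y) =
    2 * enorm a * N * (N * enorm x) * dotv y y by ring.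
  rewrite ler_wpM2r ?dotv_ge0// ler_wpM2l// !mulr_ge0// ?enorm_ge0//.
by move: h4; rewrite ler_pM2l// exprn_gt0.
Qed.

(** * The Lorentz cone, its Moreau decomposition, meet and join *)

Section Lorentz.
Context {R : realType} {m : nat}.
Implicit Types (x y z u v w p q a k : 'rV[R]_(m + 1)) (M : set 'rV[R]_(m + 1)).
Local Notation K := (@lorentz_cone R m).

Definition height z : R := z 0 (rshift m 0).

Definition axis : 'rV[R]_(m + 1) := row_mx 0 1%:M.

Lemma heightD x y : height (x + y) = height x + height y.
Proof. by rewrite /height mxE. Qed.

Lemma heightN x : height (- x) = - height x.
Proof. by rewrite /height mxE. Qed.

Lemma heightZ c x : height (c *: x) = c * height x.
Proof. by rewrite /height mxE. Qed.

Lemma height_row (u : 'rV[R]_m) t : height (row_mx u t%:M) = t.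
Proof. by rewrite /height row_mxEr mxE eqxx mulr1n. Qed.

Lemma row_height z : z = row_mx (lsubmx z) (height z)%:M.
Proof. by rewrite -[LHS]hsubmxK; congr row_mx; rewrite [LHS]mx11_scalar mxE. Qed.

Lemma dotv_lsubmx z w :
  dotv z w = dotv (lsubmx z) (lsubmx w) + height z * height w.
Proof.
rewrite /dotv big_split_ord big_ord1; congr (_ + _).
by apply: eq_bigr => i _; rewrite !mxE.
Qed.

Lemma row_mx_axis (u : 'rV[R]_m) s t :
  row_mx u s%:M + t *: axis = row_mx u (s + t)%:M.
Proof.
by rewrite scale_row_mx add_row_mx scaler0 addr0 scale_scalar_mx mulr1 raddfD.
Qed.

Lemma dotv_axis z : dotv z axis = height z.
Proof. by rewrite dotv_lsubmx row_mxKl height_row dotv0r add0r mulr1. Qed.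

Lemma lsubmx_axis : lsubmx axis = 0.
Proof. exact: row_mxKl. Qed.

Lemma enorm_height0 z : height z = 0 -> enorm z = enorm (lsubmx z).
Proof. by move=> z0; rewrite /enorm dotv_lsubmx z0 mul0r addr0. Qed.

Lemma lorentzE z : K z <-> enorm (lsubmx z) <= height z.
Proof.
split=> [[u [t [-> ut]]]|h]; first by rewrite row_mxKl height_row.
by exists (lsubmx z), (height z); split=> //; exact: row_height.
Qed.

Lemma lorentz_dotv_ge0 x y : K x -> K y -> 0 <= dotv x y.
Proof.
move=> /lorentzE hx /lorentzE hy; rewrite dotv_lsubmx.
have := dotv_le_enorm (- lsubmx x) (lsubmx y); rewrite dotvNl enormN => h.
have := ler_pM (enorm_ge0 _) (enorm_ge0 _) hx hy; lra.
Qed.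

Lemma lorentzZ c x : 0 <= c -> K x -> K (c *: x).
Proof.
move=> c0 /lorentzE hx; apply/lorentzE.
by rewrite heightZ linearZ enormZ ger0_norm// ler_wpM2l.
Qed.

Lemma lorentz0 : K 0.
Proof. by apply/lorentzE; rewrite linear0 enorm0 /height mxE. Qed.

(** Moreau decomposition: [k] and [k'] are the projections of [z] and [-z] on the cone. The clause
    on [l] is what makes cylinders invariant. *)
Lemma lorentz_decomposition z : exists k k' l,
  [/\ K k, K k', z = k - k', dotv k k' = 0 &
      [/\ 0 <= l, l <= 1 & lsubmx k = l *: lsubmx z]].
Proof.
set N := enorm (lsubmx z).
have [zN|Nz] := leP N (height z).
  exists z, 0, 1; rewrite subr0 dotv0r scale1r; split=> //; first exact/lorentzE.
  exact: lorentz0.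
have [zN|Nz'] := leP N (- height z).
  exists 0, (- z), 0; rewrite opprK add0r dotv0l scale0r linear0; split=> //.
    exact: lorentz0.
  by apply/lorentzE; rewrite linearN enormN heightN.
have N0 : 0 < N by lra.
(* Outside both cones [k] and [k'] are boundary vectors of heights [l N] and [(1 - l) N]; their
   difference [(2l - 1) N] must be the height of [z]. *)
pose l := (1 + height z / N) / 2.
have lN : l * N = (N + height z) / 2 by rewrite /l; field; rewrite gt_eqF.
have l0 : 0 <= l by rewrite -(pmulr_lge0 _ N0) lN; lra.
have l1 : l <= 1 by rewrite -(ler_pM2r N0) lN mul1r; lra.
exists (row_mx (l *: lsubmx z) (l * N)%:M).
exists (row_mx ((l - 1) *: lsubmx z) ((1 - l) * N)%:M), l.
split.
- by apply/lorentzE; rewrite row_mxKl height_row enormZ ger0_norm.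
- by apply/lorentzE; rewrite row_mxKl height_row enormZ ler0_norm ?subr_le0// opprB.
- rewrite opp_row_mx add_row_mx -scaleNr -scalerDl opprB addrCA subrr addr0 scale1r.
  rewrite [LHS]row_height -raddfB/=; congr (row_mx _ _%:M).
  by rewrite mulrBl lN; lra.
- rewrite dotv_lsubmx !row_mxKl !height_row dotvZl dotvZr -sqr_enorm -/N; ring.
- by rewrite row_mxKl.
Qed.

(** The residual [y - (x - k)] is [k'], orthogonal to [k] and nonnegative against the cone, which is
    the variational inequality for [x - K]. *)
Lemma cone_meetE x y k k' : K k -> K k' -> x - y = k - k' -> dotv k k' = 0 ->
  cone_meet K x y = x - k.
Proof.
move=> Kk Kk' xy kk.
have yE : y = x - (k - k') by rewrite -xy subKr.
apply: proj_eq => [|_ [l Kl <-]]; first by exists k.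
have -> : y - (x - k) = k' by rewrite yE; apply/rowP => i; rewrite !mxE; ring.
have -> : x - l - (x - k) = k - l by apply/rowP => i; rewrite !mxE; ring.
by rewrite dotvDr dotvNr (dotvC k') kk; have := lorentz_dotv_ge0 Kk' Kl; lra.
Qed.

(** Here [y + k = x + k'] lies in [x + K], with residual [-k] orthogonal to [k']. *)
Lemma cone_joinE x y k k' : K k -> K k' -> x - y = k - k' -> dotv k k' = 0 ->
  cone_join K x y = y + k.
Proof.
move=> Kk Kk' xy kk.
have xE : x = y + (k - k') by rewrite -xy addrC subrK.
have ykE : y + k = x + k' by rewrite xE; apply/rowP => i; rewrite !mxE; ring.
apply: proj_eq => [|_ [l Kl <-]]; first by exists k'.
have -> : y - (y + k) = - k by apply/rowP => i; rewrite !mxE; ring.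
have -> : x + l - (y + k) = l - k' by rewrite ykE; apply/rowP => i; rewrite !mxE; ring.
by rewrite dotvNl dotvDr dotvNr kk; have := lorentz_dotv_ge0 Kk Kl; lra.
Qed.

(** * From invariance to isotonicity *)

Lemma invariant_isotone_projection M : closed M -> convex_set M -> M !=set0 ->
  invariant_under (cone_meet K) M -> invariant_under (cone_join K) M ->
  isotone_projection_set K M.
Proof.
move=> cM coM M0 meetM joinM; split=> // x y Kxy.
have nx := proj_nearest x cM M0; have ny := proj_nearest y cM M0.
set u := Defs.proj M x in nx *; set v := Defs.proj M y in ny *.
have [[Mu _] [Mv _]] := (nx, ny).
have [k [k' [_ [Kk Kk' uv kk _]]]] := lorentz_decomposition (u - v).
have := nearest_dotv_le0 coM nx (meetM _ _ Mu Mv).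
have := nearest_dotv_le0 coM ny (joinM _ _ Mu Mv).
rewrite (cone_meetE Kk Kk' uv kk) (cone_joinE Kk Kk' uv kk).
rewrite (addrC v) addrK addrAC subrr add0r dotvNr.
(* The two inequalities add up to [<y - x, k> + <u - v, k> <= 0], whose first term is nonnegative
   and whose second is [|k|^2]. *)
have := lorentz_dotv_ge0 Kxy Kk; have : dotv (u - v) k = dotv k k.
  by rewrite uv dotvDl dotvNl (dotvC k') kk subr0.
rewrite !dotvDl !dotvNl => h1 h2 h3 h4.
have k0 : k = 0.
  by apply/eqP; rewrite -dotv_eq0 eq_le dotv_ge0 andbT; lra.
by rewrite /cone_le -opprB uv k0 sub0r opprK.
Qed.

(** * From isotonicity to cylinders *)

Lemma exists_unit_orthogonal (b : 'rV[R]_m) : (1 < m)%N ->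
  exists2 u : 'rV[R]_m, enorm u = 1 & dotv b u = 0.
Proof.
move=> m1; pose v := nz_row (kermx b^T).
have v0 : v != 0.
  rewrite nz_row_eq0 -mxrank_eq0 mxrank_ker subn_eq0 -ltnNge.
  by rewrite (leq_ltn_trans _ m1)// mxrank_tr rank_leq_row.
have bv : dotv b v = 0.
  have /sub_kermxP := nz_row_sub (kermx b^T); rewrite -/v => /matrixP/(_ 0 0).
  by rewrite !mxE dotvC => <-; apply: eq_bigr => i _; rewrite mxE.
exists ((enorm v)^-1 *: v); last by rewrite dotvZr bv mulr0.
by rewrite enormZ ger0_norm ?invr_ge0 ?enorm_ge0// mulVf// enorm_eq0.
Qed.

(** A nonzero height of [a] would have its square bounded, through [inner_normal_ball_proj], by a
    quantity linear in the displacement [e]. *)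
Lemma isotone_normal_height M a p : (1 < m)%N -> isotone_projection_set K M ->
  inner_normal_ball M a p -> height a = 0.
Proof.
move=> m1 [M0 cM coM iso] inb; have [_ ball _] := inb.
apply/eqP/negPn/negP => c0.
have [u u1 au] := exists_unit_orthogonal (lsubmx a) m1.
(* The sign makes both [s x] and [s y] have the positive product [|height a|] with [a]. *)
pose s := Num.sg (height a).
have s2 : s * s = 1 by rewrite -expr2 sqr_sg c0.
pose x := row_mx u 1%:M; pose y := row_mx (- u) 1%:M.
have Kx : K x by apply/lorentzE; rewrite row_mxKl height_row u1.
have Ky : K y by apply/lorentzE; rewrite row_mxKl height_row enormN u1.
have ax : dotv a (s *: x) = `|height a|.
  by rewrite dotvZr dotv_lsubmx row_mxKl height_row au add0r mulr1 normrEsg.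
have ay : dotv a (s *: y) = `|height a|.
  by rewrite dotvZr dotv_lsubmx row_mxKl height_row dotvNr au oppr0 add0r mulr1 normrEsg.
have xy : dotv x y = 0.
  by rewrite dotv_lsubmx !row_mxKl !height_row dotvNr -sqr_enorm u1; ring.
have a0 : 0 < `|height a| by rewrite normr_gt0.
have Mp : M p by apply: ball; rewrite opprB addrCA subrr addr0.
have pp : Defs.proj M p = p.
  by apply: proj_eq => // v _; rewrite subrr dotv0l.
pose B := 2 * enorm a * enorm (s *: x) * dotv (s *: y) (s *: y).
have B0 : 0 <= B by rewrite !mulr_ge0 ?enorm_ge0 ?dotv_ge0.
(* Small enough that [B e] is below the square of the height; [B + 1] avoids division by zero. *)
pose e := height a ^+ 2 / (2 * (B + 1)).
have ha : 0 < height a ^+ 2 by rewrite exprn_even_gt0.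
have e0 : 0 < e by rewrite divr_gt0//; lra.
have Kex : K (e *: x) by apply: lorentzZ => //; exact: ltW.
have := inner_normal_ball_proj (x := e *: (s *: x)) (y := s *: y) coM inb
  (proj_nearest _ cM M0).
rewrite dotvZr ax mulr_gt0// ay dotvZl dotvZl dotvZr xy !mulr0.
set q := Defs.proj _ _ => /(_ isT erefl) h.
suff : height a ^+ 2 <= B * e.
  by rewrite /e mulrA ler_pdivlMr; nra.
have -> : B * e = 2 * enorm a * enorm (e *: (s *: x)) * dotv (s *: y) (s *: y).
  by rewrite (enormZ e) gtr0_norm// /B; ring.
rewrite -real_normK ?num_real//; apply: h => //.
(* By isotonicity [q - p] lies in the cone if [s = 1] and [p - q] does if [s = -1]; either way
   [s <q - p, y> >= 0]. *)
rewrite dotvZr; move: c0; rewrite /q /s; case: (sgrP (height a)) => // hs _.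
- have : cone_le K p (p + e *: (1 *: x)).
    by rewrite /cone_le addrAC subrr add0r scale1r.
  by move=> /iso; rewrite pp mul1r => h1; exact: lorentz_dotv_ge0.
- have : cone_le K (p + e *: (-1 *: x)) p.
    by rewrite /cone_le opprD addrA subrr add0r scaleN1r scalerN opprK.
  move=> /iso; rewrite pp mulN1r -dotvNl opprB => h1; exact: lorentz_dotv_ge0.
Qed.

Lemma cylinderE (C : set 'rV[R]_m) z : cylinder C z <-> C (lsubmx z).
Proof.
split=> [[u [t [-> Cu]]]|Cz]; first by rewrite row_mxKl.
by exists (lsubmx z), (height z); split=> //; exact: row_height.
Qed.

Lemma isotone_projection_cylinder M : (1 < m)%N -> interior M !=set0 ->
  isotone_projection_set K M ->
  exists C : set 'rV[R]_m,
    [/\ closed C, convex_set C, interior C !=set0 & M = cylinder C].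
Proof.
move=> m1 intM isoM; have [_ cM coM _] := isoM.
have trM v t : M v -> M (v + t *: axis).
  apply: closed_convex_translate => // a p inb.
  by rewrite dotv_axis; exact: isotone_normal_height isoM inb.
(* Vertical translations preserve [M], so its slice at height 0 determines it. *)
exists [set u | M (row_mx u 0%:M)].
have rowB (u v : 'rV[R]_m) : enorm (row_mx u 0%:M - row_mx v 0%:M) = enorm (u - v).
  rewrite opp_row_mx add_row_mx subrr -[0 in LHS](raddf0 scalar_mx).
  by rewrite enorm_height0 ?row_mxKl ?height_row.
split.
- apply/closed_enormP => u uC; move/closed_enormP: (cM); apply=> e /uC [v Cv vu].
  by exists (row_mx v 0%:M); rewrite ?rowB.
- apply/convex_setP => u v t t0 t1 /= Mu Mv.
  have := (convex_setP M).1 coM _ _ t t0 t1 Mu Mv.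
  by rewrite !scale_row_mx add_row_mx raddf0 !scaler0 addr0.
- case: intM => z /nbhs_enormP [r r0 rM]; exists (lsubmx z).
  apply/nbhs_enormP; exists r => // u ur.
  have : M (row_mx u (height z)%:M).
    apply: rM.
    have -> : row_mx u (height z)%:M - z = row_mx (u - lsubmx z) 0%:M.
      by rewrite {2}(row_height z) opp_row_mx add_row_mx subrr raddf0.
    by rewrite enorm_height0 ?row_mxKl ?height_row.
  by move=> /(trM _ (- height z)); rewrite row_mx_axis subrr.
- apply/seteqP; split=> z; [move=> Mz; apply/cylinderE|move/cylinderE] => /=.
    by move: Mz => /(trM _ (- height z)); rewrite {1}(row_height z) row_mx_axis subrr.
  by move=> /(trM _ (height z)); rewrite row_mx_axis add0r -row_height.
Qed.

(** * Cylinders are isotone and invariant *)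

Lemma cylinder_isotone_projection (C : set 'rV[R]_m) :
  closed (cylinder C) -> convex_set (cylinder C) -> cylinder C !=set0 ->
  isotone_projection_set K (cylinder C).
Proof.
move=> cM coM M0; split=> // x y /lorentzE Kxy; apply/lorentzE.
have near x1 := proj_nearest x1 cM M0.
have hproj z : height (Defs.proj (cylinder C) z) = height z.
  have nz := near z; set p := Defs.proj _ z in nz *.
  have [Mp _] := nz.
  (* Testing against [p] moved vertically to the height of [z] shows that projection preserves
     height. *)
  have Mv : cylinder C (p + height (z - p) *: axis).
    apply/cylinderE; rewrite linearD linearZ/= lsubmx_axis scaler0 addr0.
    by apply/cylinderE.
  have := nearest_dotv_le0 coM nz Mv.
  rewrite (addrC p) addrK dotvZr dotv_axis -expr2 => h.
  apply/eqP; rewrite eq_sym -subr_eq0 -heightN -heightD.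
  by rewrite -sqrf_eq0 eq_le h sqr_ge0.
have := nearest_dotv_le0 coM (near x) (near y).1.
have := nearest_dotv_le0 coM (near y) (near x).1.
have hh : height (Defs.proj (cylinder C) y - Defs.proj (cylinder C) x) = height (y - x).
  by rewrite !heightD !heightN !hproj.
move: hh.
set p := Defs.proj _ x; set q := Defs.proj _ y => hh h1 h2.
rewrite hh; apply: le_trans Kxy.
(* Firm nonexpansiveness of the projection; the equal heights cancel, so the horizontal part of
   [q - p] is no longer than that of [y - x]. *)
have : dotv (q - p) (q - p) <= dotv (y - x) (q - p).
  have : dotv (y - q) (q - p) >= 0 by rewrite -[q - p]opprB dotvNr; lra.
  have -> : y - x = (y - q) + (q - p) - (x - p).
    by apply/rowP => i; rewrite !mxE; ring.
  by rewrite (dotvDl _ (- (x - p))) (dotvDl (y - q)) (dotvNl (x - p)); lra.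
rewrite !dotv_lsubmx hh lerD2r => h.
have [->|b0] := eqVneq (lsubmx (q - p)) 0; first by rewrite enorm0 enorm_ge0.
rewrite -(@ler_pM2r _ (enorm (lsubmx (q - p)))) ?enorm_gt0// -expr2 sqr_enorm.
exact: le_trans h (dotv_le_enorm _ _).
Qed.

(** The horizontal parts of meet and join are the convex combinations of those of [x] and [y] with
    weights [1 - l, l] and [l, 1 - l]. *)
Lemma cylinder_invariant (C : set 'rV[R]_m) : convex_set (cylinder C) ->
  invariant_under (cone_meet K) (cylinder C) /\
  invariant_under (cone_join K) (cylinder C).
Proof.
move=> /convex_setP coM; split=> x y Mx My.
- have [k [k' [l [Kk Kk' xy kk [l0 l1 kl]]]]] := lorentz_decomposition (x - y).
  rewrite (cone_meetE Kk Kk' xy kk).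
  have /cylinderE := coM y x l l0 l1 My Mx; rewrite linearD !linearZ/= => Cl.
  apply/cylinderE; rewrite linearB/= kl linearB/=.
  move: Cl; congr C; rewrite scalerBl scale1r scalerBr opprB addrC -!addrA.
  by congr (_ + _); rewrite addrC.
- have [k [k' [l [Kk Kk' xy kk [l0 l1 kl]]]]] := lorentz_decomposition (x - y).
  rewrite (cone_joinE Kk Kk' xy kk).
  have /cylinderE := coM x y l l0 l1 Mx My; rewrite linearD !linearZ/= => Cl.
  apply/cylinderE; rewrite linearD/= kl linearB/=.
  by move: Cl; congr C; rewrite scalerBl scale1r scalerBr addrCA.
Qed.

End Lorentz.

Theorem mainTheorem4 (R : realType) (m : nat) (M : set 'rV[R]_(m + 1)) :
  (1 < m)%N ->
  closed M ->
  convex_set M ->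
  interior M !=set0 ->
  ((invariant_under (cone_meet (@lorentz_cone R m)) M /\
    invariant_under (cone_join (@lorentz_cone R m)) M)
   <-> isotone_projection_set (@lorentz_cone R m) M)
  /\
  (isotone_projection_set (@lorentz_cone R m) M
   <-> exists C : set 'rV[R]_m,
         [/\ closed C, convex_set C, interior C !=set0 & M = cylinder C]).
Proof.
move=> m1 cM coM intM.
have M0 : M !=set0 by case: intM => z /nbhs_singleton; exists z.
have ciso := isotone_projection_cylinder m1 intM.
split; split=> //.
- by move=> [meetM joinM]; exact: invariant_isotone_projection.
(* Isotonicity yields invariance by way of the cylinder form. *)
- by move=> /ciso [C [_ _ _ MC]]; move: coM; rewrite MC; exact: cylinder_invariant.
- by move=> [C [_ _ _ MC]]; move: cM coM M0; rewrite MC;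
    exact: cylinder_isotone_projection.
Qed.
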